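(* Let $m$ be a positive integer, let $\mathcal{Z}$ be a measurable space, let $P$ be a probability measure on $\mathbb{R}^m$ (the law of $v$), and let $Q$ be a probability measure on $\mathcal{Z}\times\mathcal{Z}$ (the law of $(z,z')$). For a measurable function $h:\mathbb{R}^m\times\mathcal{Z}\to\mathbb{R}$ put $$\mathrm{BOI}(h)=\mathbb{E}_{v\sim P}\,\mathbb{E}_{(z,z')\sim Q}\big[(h(v,z)-h(v,z'))^2\big]\in[0,\infty].$$ Then: (1) For any skill-only matcher, i.e. any matcher $h(v,z)=f(v)$ with $f:\mathbb{R}^m\to\mathbb{R}$ measurable, $\mathrm{BOI}(h)=0$. (2) For any measurable matcher $g:\mathbb{R}^m\times\mathcal{Z}\to\mathbb{R}$ that depends on $z$ on a set of non-zero measure, i.e. such that $(P\otimes Q)\big(\{(v,z,z') : g(v,z)\neq g(v,z')\}\big)>0$, one has $\mathrm{BOI}(g)>0$.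
   Context: A candidate is described by a pair $(v,z)$, where $v\in\mathbb{R}^m$ is a skill vector and $z\in\mathcal{Z}$ collects the non-skill résumé fields. A matcher is a function $h(v,z)$ (a score or decision). It is skill-only if it is a function of $v$ alone, with no dependence on $z$. The quantity $\mathrm{BOI}(h)$ is called the Bias–Opportunity Index of $h$. *)

(* Defs.v *)
From HB Require Import structures.
From mathcomp Require Import all_boot all_order all_algebra.
From mathcomp Require Import all_classical all_reals all_analysis.

Set Implicit Arguments.
Unset Strict Implicit.
Unset Printing Implicit Defensive.

Import Order.TTheory GRing.Theory Num.Theory.

Local Open Scope classical_set_scope.
Local Open Scope ring_scope.
Local Open Scope ereal_scope.

(* Over mathcomp-analysis.  The skill space R^m is the type [m.-tuple R] with
   its library sigma-algebra, the one generated by the coordinate maps; this is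
   the Borel sigma-algebra of R^m. *)

Definition skill_only (R : realType) (m : nat) (dZ : measure_display)
    (Z : measurableType dZ) (h : m.-tuple R * Z -> R) : Prop :=
  exists2 f : m.-tuple R -> R,
    measurable_fun [set: m.-tuple R] f & forall v z, h (v, z) = f v.

(* The outer expectation is written as an integral because the library's
   ['E_P[X]] only takes real-valued [X], and the inner one may be [+oo]. *)
Definition BOI (R : realType) (m : nat) (dZ : measure_display)
    (Z : measurableType dZ) (P : probability (m.-tuple R) R)
    (Q : probability (Z * Z)%type R) (h : m.-tuple R * Z -> R) : \bar R :=
  \int[P]_v 'E_Q[fun w : Z * Z => ((h (v, w.1) - h (v, w.2)) ^+ 2)%R].

(* Main.v *)
Require Import Defs.
From HB Require Import structures.
From mathcomp Require Import all_boot all_order all_algebra.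
From mathcomp Require Import all_classical all_reals all_analysis.
From mathcomp Require Import measurable_realfun.

Set Implicit Arguments.
Unset Strict Implicit.
Unset Printing Implicit Defensive.

Import Order.TTheory GRing.Theory Num.Theory.

Local Open Scope classical_set_scope.
Local Open Scope ring_scope.
Local Open Scope ereal_scope.

(** For a skill-only matcher the squared gap between the two scores is identically zero, hence so
    are both integrals. For the converse direction, Tonelli turns the iterated integral of the
    nonnegative squared gap into one integral over [P \x Q]; [measurable_fun_gap] supplies the joint
    measurability this needs. The square is nonzero exactly where the scores differ, a set of
    positive measure, and [ge0_integral_gt0] then makes the integral positive. *)

Lemma ge0_integral_gt0 (d : measure_display) (T : measurableType d)
    (R : realType) (mu : {measure set T -> \bar R}) (f : T -> \bar R) :
  measurable_fun [set: T] f -> (forall x, 0 <= f x) ->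
  0 < mu [set x | f x <> 0] -> 0 < \int[mu]_x f x.
Proof.
move=> mf f0 muf; rewrite lt0e integral_ge0// andbT.
apply: contraTneq muf => intf0; rewrite -leNgt.
(* As [f] is its own absolute value, a zero integral makes it vanish almost everywhere: the points
   where [f] is nonzero lie in a null set [N], against the positive measure assumed. *)
have [+ _] := ae_eq_integral_abs mu measurableT mf.
under eq_integral do rewrite gee0_abs//.
move=> /(_ intf0) [N [mN muN0 subN]].
have mA : measurable [set x | f x <> 0].
  rewrite (_ : [set x | _] = setT `&` [set x | f x != 0]).
    exact: emeasurable_neq.
  by rewrite setTI; apply/seteqP; split=> x /eqP.
rewrite -[leRHS]muN0 le_measure ?inE// => x fx0; apply: subN => /= /(_ I); exact: fx0.
Qed.

Lemma measurable_fun_gap dV dZ (V : measurableType dV) (Z : measurableType dZ)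
    (R : realType) (g : V * Z -> R) :
  measurable_fun [set: V * Z] g ->
  measurable_fun [set: V * (Z * Z)]
    (fun x => (g (x.1, x.2.1) - g (x.1, x.2.2))%R).
Proof.
move=> mg.
apply: measurable_funB; apply: (measurableT_comp mg);
  apply/measurable_fun_pairP; split=> /=.
- exact: measurable_fst.
- exact: measurableT_comp measurable_fst measurable_snd.
- exact: measurable_fst.
- exact: measurableT_comp measurable_snd measurable_snd.
Qed.

Theorem proposition2 (R : realType) (m : nat) (hm : (0 < m)%N)
    (dZ : measure_display) (Z : measurableType dZ)
    (P : probability (m.-tuple R) R) (Q : probability (Z * Z)%type R) :
  (forall h : m.-tuple R * Z -> R, skill_only h -> BOI P Q h = 0) /\
  (forall g : m.-tuple R * Z -> R,
     measurable_fun [set: m.-tuple R * Z] g ->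
     0 < (P \x Q) [set x : m.-tuple R * (Z * Z) |
                     g (x.1, x.2.1) <> g (x.1, x.2.2)] ->
     0 < BOI P Q g).
Proof.
split=> [h [f _ hf]|g mg].
  apply: integral0_eq => v _; rewrite unlock.
  by apply: integral0_eq => w _; rewrite !hf subrr expr0n.
pose D (x : m.-tuple R * (Z * Z)) := ((g (x.1, x.2.1) - g (x.1, x.2.2)) ^+ 2)%R.
have mD : measurable_fun setT D.
  by apply: measurable_funX; exact: measurable_fun_gap.
(* Tonelli needs only nonnegativity and measurability, so an infinite index is allowed; [unlock]
   exposes the inner expectation as an integral. *)
have -> : BOI P Q g = \int[P \x Q]_x (D x)%:E.
  rewrite fubini_tonelli1//=.
  - by apply: eq_integral => v _; rewrite unlock.
  - exact/measurable_EFinP.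
  - by move=> x; rewrite lee_fin sqr_ge0.
move=> gap; apply: ge0_integral_gt0.
- exact/measurable_EFinP.
- by move=> x; rewrite lee_fin sqr_ge0.
(* A real square vanishes exactly when its base does, so the two sets coincide; both inclusions are
   proved by contraposition. *)
congr (0 < (P \x Q) _): gap; apply/seteqP; split=> x /= + gx; apply.
- by case: gx => /eqP; rewrite sqrf_eq0 subr_eq0 => /eqP.
- by rewrite /D gx subrr expr0n.
Qed.
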